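(* Consider the model problem $w'-G(x)w=f$ with $$G(x)=G(x;\tilde\gamma,\varepsilon)=\begin{pmatrix}0&i/\varepsilon\\ \tilde\gamma+ia(x)/\varepsilon&0\end{pmatrix},$$ in the limit $\varepsilon\to0^+$, where $\tilde\gamma>0$ is bounded and $a$ is a bounded smooth real-valued function with $a(0)=0$ and $a(x)\gtrless0$ for $x\gtrless0$. Suppose $a'(0)=1$ (Airy type). Then there does not exist a smooth family of exponential dichotomies for $w'=G(x)w$ on $x\in[-\delta,\delta]$, uniform as $\tilde\gamma\to0$, for any $\delta>0$.
   Context: An exponential dichotomy on an interval $I$ for $w'=G(x)w$ with solution operator $\mathcal S(x,y)$ is a pair of complementary projections $P_+(x),P_-(x)$, $x\in I$, with $P_\pm(x)\mathcal S(x,y)=\mathcal S(x,y)P_\pm(y)$ for $x,y\in I$, and $|P_+(x)\mathcal S(x,y)|\le Ce^{-\theta|x-y|}$ for $x>y$, $|P_-(x)\mathcal S(x,y)|\le Ce^{-\theta|x-y|}$ for $x<y$, with $C,\theta>0$. A smooth uniform family is one depending on the parameters $(\tilde\gamma,\varepsilon)$ for which $C,\theta$ and the bounds on the projections $P_\pm$ (in particular boundedness) are uniform in the parameters as $\tilde\gamma\to0$ and $\varepsilon\to0$. *)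

(* Defs.v *)
From HB Require Import structures.
From mathcomp Require Import all_boot all_order all_algebra.
From mathcomp Require Import all_classical all_reals all_analysis.
From mathcomp Require Export complex.

Set Implicit Arguments.
Unset Strict Implicit.
Unset Printing Implicit Defensive.

Import Order.TTheory GRing.Theory Num.Theory.
Import numFieldNormedType.Exports.

Local Open Scope classical_set_scope.
Local Open Scope ring_scope.
Local Open Scope complex_scope.

Section Regularity.
Context {R : realType}.

Definition smooth_real (a : R -> R) : Prop :=
  forall (n : nat) (x : R), derivable (a^`(n))%classic x 1.

(* [f] is of class C^k on the open set [U]: all iterated directional
   derivatives up to order k exist on [U] and are continuous there. *)
Fixpoint class_C {V : normedModType R} (k : nat) (U : set V) (f : V -> R)
    : Prop :=
  if k is k'.+1 then
    forall v : V, (forall p, U p -> derivable f p v) /\ class_C k' U ('D_v f)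
  else forall p, U p -> {for p, continuous f}.

Definition smooth_on {V : normedModType R} (U : set V) (f : V -> R) : Prop :=
  forall k : nat, class_C k U f.

(* R[i] is not a normed module over R in the library, so regularity of
   complex matrices is expressed on the real and imaginary parts of the
   entries. *)
Definition smooth_mx_on {V : normedModType R} {n : nat} (U : set V)
    (F : V -> 'M[R[i]]_n) : Prop :=
  forall i j : 'I_n, smooth_on U (fun p => complex.Re (F p i j)) /\
                     smooth_on U (fun p => complex.Im (F p i j)).

Definition is_derive_mx {n : nat} (F : R -> 'M[R[i]]_n) (x : R)
    (D : 'M[R[i]]_n) : Prop :=
  forall i j : 'I_n,
    is_derive x (1 : R) (fun t => complex.Re (F t i j)) (complex.Re (D i j)) /\
    is_derive x (1 : R) (fun t => complex.Im (F t i j)) (complex.Im (D i j)).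

End Regularity.

Section Dichotomies.
Context {R : realType} {n : nat}.

(* [S x y] maps the value at y of a solution of w' = G w to its value at x. *)
Definition solution_operator (G : R -> 'M[R[i]]_n)
    (S : R -> R -> 'M[R[i]]_n) : Prop :=
  forall y : R, S y y = 1%:M /\
    forall x : R, is_derive_mx (fun t => S t y) x (G x *m S x y).

(* [`|A|] is the library norm of matrices (largest modulus of an entry), which
   takes its values in R[i]; all matrix norms are equivalent, and only the
   constant C depends on the choice. *)
Definition exponential_dichotomy (I : interval R) (S : R -> R -> 'M[R[i]]_n)
    (C theta : R) (Pp Pm : R -> 'M[R[i]]_n) : Prop :=
  [/\ forall x, x \in I -> [/\ Pp x *m Pp x = Pp x, Pm x *m Pm x = Pm x
                             & Pp x + Pm x = 1%:M],
      forall x y, x \in I -> y \in I ->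
        Pp x *m S x y = S x y *m Pp y /\ Pm x *m S x y = S x y *m Pm y,
      forall x y, x \in I -> y \in I -> y < x ->
        `|Pp x *m S x y| <= (C * expR (- theta * `|x - y|))%:C
    & forall x y, x \in I -> y \in I -> x < y ->
        `|Pm x *m S x y| <= (C * expR (- theta * `|x - y|))%:C].

(* [S], [Pp] and [Pm] take the parameters (gamma, eps) as their first two
   arguments; the parameters range over the box ]0, g0[ x ]0, e0[, on which
   the constants C, theta and M are uniform. *)
Definition smooth_uniform_family (I : interval R) (g0 e0 : R)
    (S : R -> R -> R -> R -> 'M[R[i]]_n)
    (Pp Pm : R -> R -> R -> 'M[R[i]]_n) : Prop :=
  let box := [set p : R * R | 0 < p.1 < g0 /\ 0 < p.2 < e0] in
  (forall x, x \in I ->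
     smooth_mx_on box (fun p => Pp p.1 p.2 x) /\
     smooth_mx_on box (fun p => Pm p.1 p.2 x)) /\
  exists C theta M : R, [/\ 0 < C, 0 < theta
    & forall gamma eps : R, 0 < gamma < g0 -> 0 < eps < e0 ->
        exponential_dichotomy I (S gamma eps) C theta
          (Pp gamma eps) (Pm gamma eps) /\
        forall x, x \in I ->
          `|Pp gamma eps x| <= M%:C /\ `|Pm gamma eps x| <= M%:C].

End Dichotomies.

Section Model.
Context {R : realType}.

Definition model_G (a : R -> R) (gamma eps x : R) : 'M[R[i]]_2 :=
  \matrix_(i < 2, j < 2)
    if (i == 0) && (j == 1) then 0 +i* eps^-1
    else if (i == 1) && (j == 0) then gamma +i* (a x / eps)
    else 0.

End Model.

(* Main.v *)
Require Import Defs.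
From HB Require Import structures.
From mathcomp Require Import all_boot all_order all_algebra.
From mathcomp Require Import all_classical all_reals all_analysis.
From mathcomp Require Import ring lra.
Import Order.TTheory GRing.Theory Num.Theory.
Import numFieldNormedType.Exports.
Local Open Scope classical_set_scope.
Local Open Scope ring_scope.

(** Why uniform dichotomies cannot exist.  Write a solution as [w = (w1, w2)],
    so that [w1' = (i / eps) w2] and [w2' = (gamma + i a / eps) w1].  At the
    turning point [a] vanishes and the matrix [eps G] degenerates to a
    nilpotent Jordan block: near [0] the flow is a shear, in which a second
    component of size 1 makes the first one grow like [x / eps].  Let [b] be
    a constant multiple [9 D eps] of [eps].  If [w] stays bounded by [D]
    between [0] and [b], then [w2] moves by at most
    [(gamma + sup |a| / eps) D b = 9 D^2 (gamma eps + sup |a|)], which tends to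
    0 with [eps] because [a] is continuous and [a 0 = 0].  Hence [w2] keeps its
    size while [w1] is driven by about [9 D |w2 0|], beyond the bound [D] when
    [w2 0] is not small.  The same holds for negative [b]: a mode that
    is bounded on either side of the turning point, over a length
    comparable to [eps], has a small second component there.

    A uniform dichotomy contradicts this.  Let [e2] be the second basis vector.
    The solution starting at [0] from [P_+ e2] stays bounded to the right of
    [0], and the one starting from [P_- e2] stays bounded to the left, both with
    a bound that does not depend on the parameters.  So both second components
    have real part less than 1/2, although their sum is 1.  All this happens for
    one fixed [gamma] and one sufficiently small [eps].

    The estimate is [shear_unbounded] for real functions and
    [model_mode_unbounded] for the model system. *)

(** Parametrizing the segment from [0] to [b] by [t * b] with [t] in the unit
    interval treats both signs of [b], that is both sides of the turning
    point, at once. *)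
Lemma mean_value_from0 (R : realType) (f df : R -> R) (b : R) :
  (forall x : R, is_derive x (1 : R) f (df x)) ->
  exists2 t : R, 0 <= t <= 1 & f b - f 0 = df (t * b) * b.
Proof.
move=> dfE; pose g := f \o ( *%R^~ b).
have dg (x : R) : is_derive x (1 : R) g (b * df (x * b)).
  have db : is_derive x (1 : R) ( *%R^~ b) b.
    by apply: is_derive_eq; rewrite scaler0 add0r /GRing.scale/= mulr1.
  rewrite -[X in is_derive _ _ _ X]mulrC; exact: is_derive1_comp.
have cg : {within `[0, 1], continuous g}.
  apply/continuous_subspaceT => x; apply/differentiable_continuous.
  exact/derivable1_diffP.
have [t t01] := MVT_segment ler01 (fun x _ => dg x) cg.
rewrite /g /= mul1r mul0r subr0 mulr1 mulrC => ->.
by exists t => //; move: t01; rewrite in_itv.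
Qed.

(** The slope of [u] is [v / eps], and [v] cannot drop below [1 / 4] because
    its total variation over the segment is at most [kappa * `|b|]; so [u] moves
    by at least [`|b| / (4 * eps)], which exceeds [2 * D]. *)
Lemma shear_unbounded (R : realType) (u v dv : R -> R) (eps kappa D b : R) :
  0 < eps -> 8 * D * eps < `|b| -> kappa * `|b| <= 1 / 4 ->
  (forall x : R, is_derive x (1 : R) u (v x / eps)) ->
  (forall x : R, is_derive x (1 : R) v (dv x)) ->
  (forall t : R, 0 <= t <= 1 -> `|dv (t * b)| <= kappa) ->
  1 / 2 <= v 0 ->
  2 * D < `|u b - u 0|.
Proof.
move=> eps0 Db kb du dvE dvk v0.
have [t /andP[t0 t1] ->] := mean_value_from0 _ _ _ b du.
have [s /andP[s0 s1] vE] := mean_value_from0 _ _ _ (t * b) dvE.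
have dvs : `|dv (s * (t * b))| <= kappa.
  by rewrite mulrA dvk// mulr_ge0//= mulr_ile1.
have vt : 1 / 4 <= v (t * b).
  have : `|v (t * b) - v 0| <= 1 / 4.
    rewrite vE normrM; apply: le_trans kb; apply: ler_pM => //.
    by rewrite normrM (ger0_norm t0) ler_piMl.
  by move/ler_normlP => [+ _]; lra.
rewrite normrM (@ger0_norm _ (v (t * b) / eps)); last by rewrite divr_ge0; lra.
have bE : `|b| / eps > 8 * D by rewrite ltr_pdivlMr.
have be0 : 0 <= `|b| / eps by rewrite divr_ge0// ltW.
have : (v (t * b) - 1 / 4) * (`|b| / eps) >= 0 by rewrite mulr_ge0// subr_ge0.
lra.
Qed.

Lemma normc_ge_Im (R : rcfType) (z : R[i]) : (`|complex.Im z|%:C <= `|z|)%C.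
Proof.
have -> : `|z| = `|z * 'i%C|.
  by rewrite normrM [`|'i%C|]normc_def/= expr0n/= add0r expr1n sqrtr1 mulr1.
by rewrite -normrN -ReiNIm normc_ge_Re.
Qed.

Lemma mx_entry_bound (R : rcfType) (m n : nat) (A : 'M[R[i]]_(m, n)) (D : R)
    (i : 'I_m) (j : 'I_n) :
  `|A| <= (D%:C)%C -> `|complex.Re (A i j)| <= D /\ `|complex.Im (A i j)| <= D.
Proof.
move=> AD; have AijD : `|A i j| <= (D%:C)%C.
  apply: le_trans AD; rewrite [leRHS]mx_normE -[leLHS]nngE num_le.
  exact: (le_bigmax _ (fun k : 'I_m * 'I_n => `|A k.1 k.2|%:nng) (i, j)).
by split; rewrite -lecR; apply: le_trans AijD;
  [exact: normc_ge_Re | exact: normc_ge_Im].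
Qed.

(** Right multiplication turns the solution operator into the matrix whose
    columns are the solutions issued from the columns of [B]. *)
Lemma is_derive_mx_mulr (R : realType) (n : nat) (F : R -> 'M[R[i]]_n)
    (D B : 'M[R[i]]_n) (x : R) :
  is_derive_mx F x D -> is_derive_mx (fun t => F t *m B) x (D *m B).
Proof.
move=> dF i j; split.
- have -> : (fun t => complex.Re ((F t *m B) i j)) =
      \sum_(k < n) (fun t => complex.Re (F t i k) * complex.Re (B k j)
                     - complex.Im (F t i k) * complex.Im (B k j)).
    apply/funext => t; rewrite mxE fct_sumE raddf_sum; apply: eq_bigr => k _ /=.
    by case: (F t i k) (B k j) => [? ?] [? ?].
  rewrite mxE raddf_sum; apply: is_derive_sum => k.
  have [dRe dIm] := dF i k; apply: is_derive_eq.
  case: (D i k) (B k j) => [p q] [r s] /=.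
  by rewrite /GRing.scale/=; ring.
- have -> : (fun t => complex.Im ((F t *m B) i j)) =
      \sum_(k < n) (fun t => complex.Re (F t i k) * complex.Im (B k j)
                     + complex.Im (F t i k) * complex.Re (B k j)).
    apply/funext => t; rewrite mxE fct_sumE raddf_sum; apply: eq_bigr => k _ /=.
    by case: (F t i k) (B k j) => [? ?] [? ?].
  rewrite mxE raddf_sum; apply: is_derive_sum => k.
  have [dRe dIm] := dF i k; apply: is_derive_eq.
  case: (D i k) (B k j) => [p q] [r s] /=.
  by rewrite /GRing.scale/=; ring.
Qed.

(** The second column of [W] is a solution whose second component starts with
    real part at least [1 / 2].  The factor [i / eps] couples the real part of
    the second component to the imaginary part of the first one, and these two
    real functions form the shear.  The length [9 * D * eps] is long enough to
    move the first component by more than the diameter [2 * D] allowed by the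
    bound, while [72 * D ^+ 2 * alpha <= 1] limits the variation of the
    second one, [9 * D ^+ 2 * (gamma * eps + alpha)], to [1 / 4]. *)
Lemma model_mode_unbounded (R : realType) (a : R -> R)
    (W : R -> 'M[R[i]]_2) (gamma eps alpha D b : R) :
  (forall x : R, is_derive_mx W x (model_G a gamma eps x *m W x)) ->
  0 < gamma -> 0 < eps -> 0 < D ->
  `|b| = 9 * D * eps -> gamma * eps <= alpha -> 72 * D ^+ 2 * alpha <= 1 ->
  (forall t : R, 0 <= t <= 1 -> `|a (t * b)| <= alpha) ->
  (forall t : R, 0 <= t <= 1 -> `|W (t * b)| <= (D%:C)%C) ->
  1 / 2 <= complex.Re (W 0 1 1) -> False.
Proof.
move=> dW gam0 eps0 D0 bE gea Dalpha ab WD v0.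
pose u x := complex.Im (W x 0 1); pose v x := complex.Re (W x 1 1).
pose dv x := gamma * complex.Re (W x 0 1) - a x / eps * u x.
pose kappa := (gamma + alpha / eps) * D.
have du x : is_derive x (1 : R) u (v x / eps).
  have [_] := dW x 0 1; rewrite mxE big_ord_recl big_ord1 !mxE/=.
  rewrite /u /v; have -> : lift ord0 ord0 = 1 :> 'I_2 by apply/val_inj.
  case: (W x 1 1) => [p q]; case: (W x ord0 1) => [r s] /=.
  by rewrite !mul0r !add0r mulrC.
have dvE x : is_derive x (1 : R) v (dv x).
  have [+ _] := dW x 1 1; rewrite mxE big_ord_recl big_ord1 !mxE/=.
  rewrite /dv /u; have -> : ord0 = 0 :> 'I_2 by apply/val_inj.
  case: (W x 0 1) => [p q]; case: (W x (lift 0 0) 1) => [r s] /=.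
  by rewrite !mul0r subr0 addr0.
have dvk t : 0 <= t <= 1 -> `|dv (t * b)| <= kappa.
  move=> t01; have [ReD ImD] := mx_entry_bound _ _ _ _ _ 0 1 (WD t t01).
  rewrite /dv /kappa mulrDl; apply: le_trans (ler_normB _ _) _; apply: lerD.
    by rewrite normrM gtr0_norm// ler_wpM2l// ltW.
  rewrite !normrM normfV (gtr0_norm eps0) ler_pM//.
    by rewrite divr_ge0// ltW.
  by rewrite ler_wpM2r ?ab// invr_ge0 ltW.
have /= := shear_unbounded _ u v dv eps kappa D b eps0 _ _ du dvE dvk v0.
rewrite bE /kappa.
have -> : (gamma + alpha / eps) * D * (9 * D * eps)
    = 9 * D ^+ 2 * (gamma * eps + alpha) by field; rewrite gt_eqF.
have De : 0 < D * eps by rewrite mulr_gt0.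
have D2 : D ^+ 2 * (alpha - gamma * eps) >= 0.
  by rewrite mulr_ge0 ?sqr_ge0// subr_ge0.
move=> /(_ ltac:(lra) ltac:(lra)); apply/negP; rewrite -leNgt.
apply: le_trans (ler_normB _ _) _.
have [_ +] := mx_entry_bound _ _ _ _ _ 0 1 (WD 1 ltac:(lra)).
have [_ +] := mx_entry_bound _ _ _ _ _ 0 1 (WD 0 ltac:(lra)).
rewrite mul0r mul1r /u; lra.
Qed.

Theorem proposition5p2 (R : realType) (a : R -> R)
  (S : R -> R -> R -> R -> 'M[R[i]]_2)
  (a_smooth : smooth_real a)
  (a_bounded : exists B : R, forall x : R, `|a x| <= B)
  (a_zero : a 0 = 0)
  (a_pos : forall x : R, 0 < x -> 0 < a x)
  (a_neg : forall x : R, x < 0 -> a x < 0)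
  (airy_type : (a^`())%classic 0 = 1)
  (S_solution : forall gamma eps : R, 0 < gamma -> 0 < eps ->
     solution_operator (model_G a gamma eps) (S gamma eps)) :
  forall delta : R, 0 < delta ->
    ~ exists (g0 e0 : R) (Pp Pm : R -> R -> R -> 'M[R[i]]_2),
        [/\ 0 < g0, 0 < e0
          & smooth_uniform_family `[- delta, delta] g0 e0 S Pp Pm].
Proof.
move=> delta delta0 [g0 [e0 [Pp [Pm [g00 e00]]]]].
move=> [_ [C [theta [M [C0 theta0 dich]]]]].
pose D := C + `|M| + 1; have D0 : 0 < D by rewrite /D; have := normr_ge0 M; lra.
(* The largest size of [a] near the turning point compatible with the hypothesis
   [72 * D ^+ 2 * alpha <= 1] of [model_mode_unbounded]. *)
pose alpha := (72 * D ^+ 2)^-1.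
have alpha0 : 0 < alpha by rewrite invr_gt0 mulr_gt0// exprn_gt0.
have a_cont : {for 0, continuous a}.
  exact/differentiable_continuous/derivable1_diffP/(a_smooth 0%N).
have [r r0 ar] : exists2 r : R, 0 < r & forall x, `|x| < r -> `|a x| <= alpha.
  have /cvgrPdist_le/(_ _ alpha0)/nbhs_ballP[r /= r0 ar] := a_cont.
  exists r => // x xr; have := ar x; rewrite a_zero sub0r normrN; apply.
  by rewrite /ball/= sub0r normrN.
(* Any value below both [g0] and 1 would do: [gamma <= 1] gives
   [gamma * eps <= alpha] as soon as [eps <= alpha]. *)
pose gamma := g0 / (g0 + 1).
have gam : [/\ 0 < gamma, gamma < g0 & gamma <= 1].
  rewrite /gamma; split; first by rewrite divr_gt0; lra.
  - by rewrite ltr_pdivrMr; nra.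
  - by rewrite ler_pdivrMr; lra.
case: gam => gam0 gamg0 gam1.
have [eps [eps0 epse0 epsalpha epsr epsdelta]] : exists eps : R,
    [/\ 0 < eps, eps < e0, eps < alpha, 9 * D * eps < r & 9 * D * eps < delta].
  near (0:R)^'+ => eps; exists eps.
  split.
  - by near: eps; exact: nbhs_right_gt.
  - by near: eps; exact: nbhs_right_lt.
  - by near: eps; exact: nbhs_right_lt.
  - rewrite mulrC -ltr_pdivlMr; last lra.
    by near: eps; apply: nbhs_right_lt; rewrite divr_gt0//; lra.
  - rewrite mulrC -ltr_pdivlMr; last lra.
    by near: eps; apply: nbhs_right_lt; rewrite divr_gt0//; lra.
have [[proj commS Pp_decay Pm_decay] PM] :=
  dich gamma eps (introT andP (conj gam0 gamg0)) (introT andP (conj eps0 epse0)).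
have I0 : 0 \in `[- delta, delta] by rewrite in_itv /=; lra.
have [S00 dS] := S_solution _ _ gam0 eps0 0.
have le_D (A : 'M[R[i]]_2) (c : R) :
    `|A| <= (c%:C)%C -> c <= D -> `|A| <= (D%:C)%C.
  by move=> Ac cD; apply: le_trans Ac _; rewrite lecR.
have CD (x : R) : C * expR (- theta * `|x|) <= D.
  apply: (@le_trans _ _ C); last by rewrite /D; have := normr_ge0 M; lra.
  rewrite -[leRHS]mulr1 ler_pM2l// -[leRHS]expR0 ler_expR mulNr oppr_le0.
  by rewrite mulr_ge0// ltW.
have MD : M <= D by rewrite /D; have := ler_norm M; lra.
(* Both projections at the turning point go through the following claim, with
   [b] positive for [Pp] and negative for [Pm]. *)
have no_mode (P : 'M[R[i]]_2) (b : R) : `|b| = 9 * D * eps ->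
    (forall t : R, 0 <= t <= 1 -> `|S gamma eps (t * b) 0 *m P| <= (D%:C)%C) ->
    complex.Re (P 1 1) < 1 / 2.
  move=> bE PD; rewrite ltNge; apply/negP => v0.
  apply: (model_mode_unbounded R a (fun t => S gamma eps t 0 *m P)
    gamma eps alpha D b) => //.
  - by move=> x; rewrite mulmxA; apply: is_derive_mx_mulr.
  - by apply: le_trans (ltW epsalpha); rewrite ler_piMl// ltW.
  - by rewrite /alpha mulfV// gt_eqF// mulr_gt0// exprn_gt0.
  - move=> t /andP[t0 t1]; apply: ar; apply: le_lt_trans epsr.
    by rewrite normrM ger0_norm// -bE ler_piMl.
  - by rewrite S00 mul1mx.
have b0 : 0 < 9 * D * eps by rewrite !mulr_gt0.
have inI (b t : R) : `|b| = 9 * D * eps -> 0 <= t <= 1 ->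
    t * b \in `[- delta, delta].
  move=> bE /andP[t0 t1]; rewrite in_itv/= -ler_norml.
  apply: le_trans (ltW epsdelta).
  by rewrite normrM ger0_norm// -bE ler_piMl.
have Pp_lt : complex.Re (Pp gamma eps 0 1 1) < 1 / 2.
  have bE : `|9 * D * eps| = 9 * D * eps by rewrite gtr0_norm.
  apply: (no_mode _ _ bE) => t t01; have tI := inI _ _ bE t01.
  have [/= t0 _] := andP t01; move: t0; rewrite le_eqVlt => /predU1P[<-|t0].
    by rewrite mul0r S00 mul1mx; apply: (le_D _ _ _ MD); have [] := PM 0 I0.
  (* Commutation with [S] turns the solution issued from [Pp] at 0 into the
     product that the dichotomy bounds. *)
  have [<- _] := commS _ _ tI I0.
  by apply: le_D (CD _); apply: Pp_decay => //; rewrite mulr_gt0.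
have Pm_lt : complex.Re (Pm gamma eps 0 1 1) < 1 / 2.
  have bE : `|- (9 * D * eps)| = 9 * D * eps by rewrite normrN gtr0_norm.
  apply: (no_mode _ _ bE) => t t01; have tI := inI _ _ bE t01.
  have [/= t0 _] := andP t01; move: t0; rewrite le_eqVlt => /predU1P[<-|t0].
    by rewrite mul0r S00 mul1mx; apply: (le_D _ _ _ MD); have [] := PM 0 I0.
  have [_ <-] := commS _ _ tI I0.
  apply: le_D (CD _); apply: Pm_decay => //.
  by rewrite mulrN oppr_lt0 mulr_gt0.
have [_ _ /matrixP/(_ 1 1)/(congr1 (@complex.Re _))] := proj 0 I0.
rewrite !mxE raddfD /=; lra.
Unshelve. all: by end_near.
Qed.
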